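(* Let $\ell\ge d$. For every $m\ge 0$ and every $v\in\mathbb{Z}^{n+1}$ of degree $dm+\ell$ consider the $K$-linear map $$\pi_{v,\ell}\colon \mathcal{D}_{v,\ell}\to \mathcal{B}_{v,\ell}\oplus\mathcal{D}_{v,\ell-d},\qquad G\mapsto G|_{B(v,\ell)}+(FG)|_{D(v,\ell-d)}.$$ The map $\pi_{v,\ell}$ may be represented by a matrix whose entries lie in $R$ and are independent of $v$. Moreover, there exist a nonzero constant $\lambda_\ell\in R$ (not depending on $v$) and $K$-linear maps $$\psi_{v,\ell}\colon \mathcal{B}_{v,\ell}\oplus\mathcal{D}_{v,\ell-d}\to\mathcal{D}_{v,\ell}$$ such that the composition $\psi_{v,\ell}\circ\pi_{v,\ell}\colon\mathcal{D}_{v,\ell}\to\mathcal{D}_{v,\ell}$ restricts to scalar multiplication by $(m+1)\lambda_\ell$ on $\mathcal{E}_{v,\ell}$. The map $\psi_{v,\ell}$ may be represented by a matrix whose entries are $R$-linear combinations of $1,v_0,\dots,v_n$ and $m$, i.e. values at $(v,m)$ of polynomials in $R[v_0,\dots,v_n,m]$ of degree at most $1$ (the polynomials themselves not depending on $v$ and $m$).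
   Context: $R$ is $\mathbb{Z}$ or $\mathbb{F}_p$ ($p$ prime), $K$ is its fraction field, $n$ is a nonnegative integer, $R[x]=R[x_0,\dots,x_n]$, and $R[x^{\pm}]=R[x_0^{\pm1},\dots,x_n^{\pm1}]$; similarly over $K$. For $v\in\mathbb{Z}^{n+1}$, $x^v=x_0^{v_0}\cdots x_n^{v_n}$ and $\deg v=\sum_i v_i$; $G_v$ is the coefficient of $x^v$ in $G$. Integers are regarded as elements of $R$ via $\mathbb{Z}\to R$. For $S\subseteq\mathbb{Z}^{n+1}$, $K[x^\pm]_S$ is the $K$-space of Laurent polynomials supported on $S$, and $G|_S=\sum_{v\in S}G_vx^v$. A subscript $\ell\in\mathbb{Z}$ denotes the homogeneous part of degree $\ell$. Let $D_\ell=\{w\in\mathbb{Z}_{\ge0}^{n+1}:\deg w=\ell\}$ (empty for $\ell<0$), $D(v,\ell)=\{v-w:w\in D_\ell\}$, and $\mathcal{D}_{v,\ell}=K[x^\pm]_{D(v,\ell)}$. Fix an integer $d\ge2$ with $d\ne0$ in $R$ and a homogeneous polynomial $F\in R[x]_d$ of degree $d$. Put $\partial_i=x_i\frac{\partial}{\partial x_i}$ and let $I_F=\langle\partial_0F,\dots,\partial_nF\rangle\subseteq K[x]$. For each $\ell$ fix a subset $B_\ell\subseteq D_\ell$ such that $\{x^\beta:\beta\in B_\ell\}$ projects to a basis of $K[x]_\ell/(I_F)_\ell$. Put $B(v,\ell)=\{v-\beta:\beta\in B_\ell\}$ and $\mathcal{B}_{v,\ell}=K[x^\pm]_{B(v,\ell)}$.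 For $m\ge0$, $\ell\ge d$ and $v\in\mathbb{Z}^{n+1}$ of degree $dm+\ell$, $\mathcal{E}_{v,\ell}$ is the $K$-subspace of all $G\in\mathcal{D}_{v,\ell}$ satisfying $$(v_i-s_i)\sum_{t\in D_d}F_tG_{v-s-t}=(m+1)\sum_{t\in D_d}t_iF_tG_{v-s-t}\qquad\text{for all } s\in D_{\ell-d},\ i=0,\dots,n.$$ Matrices are taken with respect to monomial bases: $\mathcal{D}_{v,\ell}$ has basis $x^{v-u}$ indexed by $u\in D_\ell$, $\mathcal{B}_{v,\ell}$ has basis $x^{v-\beta}$ indexed by $\beta\in B_\ell$, so that index sets do not depend on $v$. The sum $\mathcal{B}_{v,\ell}\oplus\mathcal{D}_{v,\ell-d}$ is an internal direct sum in $K[x^\pm]$ (the two summands are in different degrees $dm$ and $dm+d$). *)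

(* Defs.v *)
From HB Require Import structures.
From mathcomp Require Import all_boot all_order all_algebra.
From mathcomp Require Export fraction.
From mathcomp Require Export freeg mpoly.

Set Implicit Arguments.
Unset Strict Implicit.
Unset Printing Implicit Defensive.

Import GRing.Theory.
Local Open Scope ring_scope.

Variant base_ring : idomainType -> Prop :=
  | BaseZ : base_ring int
  | BaseFp p : prime p -> base_ring 'F_p.

Notation tofrac := FracField.tofrac.

(** Exponents in Z^(n+1), and Laurent polynomials in x_0, ..., x_n: the latter
    are the finitely supported functions on exponents, [coeff v G] being the
    coefficient of x^v and [<< c *g v >>] the term c x^v. *)
Notation expo n := {ffun 'I_n.+1 -> int}.
Notation laurent n K := {freeg (expo n) / K}.

Definition edeg n (v : expo n) : int := \sum_i v i.

(** The set D_l of exponents of degree l, as a finite type; the (vacuous) bound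
    mdeg w < l.+1 only serves to obtain finiteness from the library. *)
Definition mons (n l : nat) := {w : 'X_{1..n.+1 < l.+1} | mdeg w == l}.
HB.instance Definition _ n l := Finite.on (mons n l).

Definition mons_val n l (w : mons n l) : 'X_{1..n.+1} := val (val w).
Coercion mons_val : mons >-> multinom.

Definition mexpo n (w : 'X_{1..n.+1}) : expo n := [ffun i => (w i)%:Z].

Section Laurent.
Variables (n : nat) (K : fieldType).
Implicit Types (S T : {pred expo n}) (G H : laurent n K).

Definition laurent_of_mpoly (P : {mpoly K[n.+1]}) : laurent n K :=
  \sum_(t <- msupp P) << P@_t *g mexpo t >>.

Definition lmul G H : laurent n K :=
  \sum_(t <- dom G) \sum_(u <- dom H) << coeff t G * coeff u H *g t + u >>.

Definition lrestr S G : laurent n K :=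
  \sum_(u <- dom G | u \in S) << coeff u G *g u >>.

Definition lsupported S : {pred laurent n K} :=
  [pred G | all (fun u => u \in S) (dom G)].

Lemma lsupportedP S G :
  reflect (forall u, u \notin S -> coeff u G = 0) (G \in lsupported S).
Proof.
apply: (iffP allP) => [h u uS | h u].
  by apply: coeff_outdom; apply: contra uS => /h.
by rewrite mem_dom; apply: contraR => /h ->.
Qed.

Lemma lsupported_submod_closed S : submod_closed (lsupported S).
Proof.
split=> [|c G H /lsupportedP hG /lsupportedP hH].
  by apply/lsupportedP => u _; rewrite coeff0.
by apply/lsupportedP => u uS; rewrite coeffD coeffZ hG // hH // mulr0 addr0.
Qed.

HB.instance Definition _ S :=
  GRing.isSubmodClosed.Build K (laurent n K) (lsupported S)
    (lsupported_submod_closed S).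

(** K[x^+-]_S, the K-space of Laurent polynomials supported on S. *)
Record lspace S := LSpace { lval :> laurent n K; _ : lval \in lsupported S }.

HB.instance Definition _ S := [isSub for @lval S].
HB.instance Definition _ S := [Choice of lspace S by <:].
HB.instance Definition _ S := [SubChoice_isSubLmodule of lspace S by <:].

Lemma coeff_lrestr S G u : coeff u (lrestr S G) = (u \in S)%:R * coeff u G.
Proof.
rewrite raddf_sum /= (eq_bigr (fun w => coeff w G * (w == u)%:R)); last first.
  by move=> w _; rewrite coeffU.
have [ud|ud] := boolP (u \in dom G); last first.
  rewrite (coeff_outdom ud) mulr0 big_seq_cond big1 // => w /andP[wd _].
  by case: eqP => [wu|_]; rewrite ?mulr0 //; rewrite -wu wd in ud.
rewrite big_mkcond (bigD1_seq u) ?uniq_dom //= eqxx mulr1 big1 ?addr0.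
  by case: (u \in S); rewrite ?mul1r ?mul0r.
by move=> w /negbTE ->; rewrite mulr0 if_same.
Qed.

Lemma coeff_lmul G H u :
  coeff u (lmul G H) = \sum_(t <- dom G) coeff t G * coeff (u - t) H.
Proof.
rewrite raddf_sum /=; apply: eq_bigr => t _.
rewrite raddf_sum /= (eq_bigr (fun w =>
  coeff t G * (coeff w H * (w == u - t)%:R))); last first.
  by move=> w _; rewrite coeffU mulrA [w == _]eq_sym subr_eq eq_sym addrC.
rewrite -big_distrr /=; congr (_ * _).
have [ud|ud] := boolP ((u - t) \in dom H); last first.
  rewrite (coeff_outdom ud) big_seq big1 // => w wd.
  by case: eqP => [wu|_]; rewrite ?mulr0 //; rewrite -wu wd in ud.
rewrite (bigD1_seq (u - t)) ?uniq_dom //= eqxx mulr1 big1 ?addr0 //.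
by move=> w /negbTE ->; rewrite mulr0.
Qed.

Lemma lrestr_supported S G : lrestr S G \in lsupported S.
Proof.
by apply/lsupportedP => u /negbTE uS; rewrite coeff_lrestr uS mul0r.
Qed.

Lemma lsupportedU S T G :
  G \in lsupported [predU S & T] <->
  exists A B, [/\ A \in lsupported S, B \in lsupported T & G = A + B].
Proof.
split=> [/lsupportedP hG|[A [B [/lsupportedP hA /lsupportedP hB ->]]]].
  exists (lrestr S G), (lrestr [predD T & S] G); split.
  - exact: lrestr_supported.
  - apply/lsupportedP => u uT.
    by rewrite coeff_lrestr inE /= (negbTE uT) andbF mul0r.
  - apply/eqP/freeg_eqP => u; rewrite coeffD !coeff_lrestr !inE /=.
    case uS: (u \in S); first by rewrite mul1r mul0r addr0.
    case uT: (u \in T); first by rewrite mul1r mul0r add0r.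
    by rewrite hG ?mulr0 ?addr0 // inE /= uS uT.
apply/lsupportedP => u; rewrite inE negb_or => /andP[uS uT].
by rewrite coeffD hA // hB // addr0.
Qed.

(** Matrices are families indexed by finite types I (columns) and J (rows).
    With monomial bases x^(e i) of the source and x^(f j) of the target,
    coordinates are coefficients. *)
Definition represents (I J : finType) (e : I -> expo n) (f : J -> expo n)
    S T (phi : lspace S -> lspace T) (A : J -> I -> K) : Prop :=
  forall (G : lspace S) (j : J),
    coeff (f j) (lval (phi G)) = \sum_i A j i * coeff (e i) (lval G).

End Laurent.

Section Spaces.
Variables (n l : nat).
Implicit Types (v : expo n) (B : {set mons n l}).

(** D(v, l) and B(v, l), for B = B_l. *)
Definition Dexps v : seq (expo n) := [seq v - mexpo w | w : mons n l].
Definition Bexps B v : seq (expo n) := [seq v - mexpo b | b : mons n l in B].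

(** Monomial bases of D_{v,l} and of B_{v,l} (+) D_{v,l-d}, with index types
    independent of v. *)
Definition Dbasis v (u : mons n l) : expo n := v - mexpo u.

Definition BDindex (d : nat) B : finType :=
  ({b : mons n l | b \in B} + mons n (l - d))%type.

Definition BDbasis (d : nat) B v (k : BDindex d B) : expo n :=
  match k with
  | inl b => v - mexpo (val b : mons n l)
  | inr s => v - mexpo (s : mons n (l - d))
  end.

End Spaces.

(** The internal direct sum B_{v,l} (+) D_{v,l-d} is the space supported on the
    union of the two supports, see [lsupportedU] and [BD_direct]. *)
Definition BDexps n d l (B : {set mons n l}) (v : expo n) : {pred expo n} :=
  [predU Bexps B v & Dexps (l - d) v].

Notation Dspace K l v := (lspace K (mem (Dexps l v))).
Notation Bspace K B v := (lspace K (mem (Bexps B v))).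
Notation BDspace K d B v := (lspace K (BDexps d B v)).

Lemma edegB n (v w : expo n) : edeg (v - w) = edeg v - edeg w.
Proof.
by rewrite /edeg -sumrB; apply: eq_bigr => i _; rewrite !ffunE.
Qed.

Lemma edeg_mons n l (w : mons n l) : edeg (mexpo w) = l%:Z.
Proof.
have dw : mdeg w = l by apply/eqP/(valP w).
rewrite -[in RHS]dw mdegE -[RHS]natz natr_sum; apply: eq_bigr => i _.
by rewrite ffunE natz.
Qed.

Lemma BD_direct (K : fieldType) n d l (B : {set mons n l}) (v : expo n)
    (G : laurent n K) : (0 < d <= l)%N ->
  G \in lsupported (mem (Bexps B v)) ->
  G \in lsupported (mem (Dexps (l - d) v)) -> G = 0.
Proof.
move=> /andP[d0 dl] /lsupportedP hB /lsupportedP hD.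
apply/eqP/freeg_eqP => u; rewrite coeff0.
have [/imageP[b _ ub]|] := boolP (u \in Bexps B v); last exact: hB.
apply: hD; apply/negP => /imageP[w _ uw].
have: edeg u = edeg u by [].
rewrite {1}ub uw !edegB !edeg_mons => /addrI/oppr_inj[] ll.
by move: d0; rewrite -(subKn dl) -ll subnn.
Qed.

Section Main.
Variables (R : idomainType) (n d : nat) (F : {mpoly R[n.+1]}).
Local Notation K := {fraction R}.

Definition FK : {mpoly K[n.+1]} := map_mpoly (@tofrac R) F.

Definition euler (i : 'I_n.+1) (P : {mpoly K[n.+1]}) : {mpoly K[n.+1]} :=
  'X_i * P^`M(i).

Definition in_IF (P : {mpoly K[n.+1]}) : Prop :=
  exists c : 'I_n.+1 -> {mpoly K[n.+1]}, P = \sum_i c i * euler i FK.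

(** {x^b : b in B} projects to a basis of K[x]_l / (I_F)_l: linear independence
    and generation, modulo I_F. *)
Definition quotient_basis l (B : {set mons n l}) : Prop :=
  (forall c : mons n l -> K,
     in_IF (\sum_(b : mons n l | b \in B) c b *: 'X_[b]) ->
     forall b, b \in B -> c b = 0) /\
  (forall P : {mpoly K[n.+1]}, P \is l.-homog ->
     exists c : mons n l -> K,
       in_IF (P - \sum_(b : mons n l | b \in B) c b *: 'X_[b])).

Section Pi.
Variables (l : nat) (B : {set mons n l}) (v : expo n).

Definition pi_val (G : laurent n K) : laurent n K :=
  lrestr (mem (Bexps B v)) G +
  lrestr (mem (Dexps (l - d) v)) (lmul (laurent_of_mpoly FK) G).

Lemma pi_valP (G : Dspace K l v) :
  pi_val (lval G) \in lsupported (BDexps d B v).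
Proof.
apply/lsupportedU; exists (lrestr (mem (Bexps B v)) G).
exists (lrestr (mem (Dexps (l - d) v)) (lmul (laurent_of_mpoly FK) G)).
by split=> //; apply: lrestr_supported.
Qed.

Definition pi_map (G : Dspace K l v) : BDspace K d B v := LSpace (pi_valP G).

Lemma pi_map_is_linear : linear pi_map.
Proof.
move=> c G H; apply/val_inj/eqP/freeg_eqP => u /=.
rewrite !(coeffD, coeffZ, coeff_lrestr, coeff_lmul).
under eq_bigr do rewrite coeffD coeffZ mulrDr mulrCA.
by rewrite big_split -mulr_sumr /= !mulrDr addrACA ![c * (_ * _)]mulrCA.
Qed.

HB.instance Definition _ :=
  GRing.isLinear.Build K (Dspace K l v) (BDspace K d B v) _ pi_map
    pi_map_is_linear.

End Pi.

Definition in_E (m l : nat) (v : expo n) (G : Dspace K l v) : Prop :=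
  forall (s : mons n (l - d)) (i : 'I_n.+1),
    (v i - (s i)%:Z)%:~R *
      (\sum_(t : mons n d) tofrac F@_t * coeff (v - mexpo s - mexpo t) (lval G))
    = (m.+1)%:R *
      (\sum_(t : mons n d)
         (t i)%:R * tofrac F@_t * coeff (v - mexpo s - mexpo t) (lval G)).

End Main.

Arguments pi_map {R n} d F {l} B v G.
Arguments in_E {R n} d F m {l v} G.

(* Main.v *)
(** For u in D_l write x^u = sum_b c_b x^b + sum_i g_i (d_i F) with the g_i
    homogeneous of degree l - d. Multiplying by G and taking the coefficient
    of x^v expresses G_{v-u} through the G_{v-b} and the coefficients of the
    (d_i F) G. The equations defining E turn m + 1 times the coefficient of
    x^(v-s) in (d_i F) G into (v_i - s_i) times the one in F G, so that
    (m + 1) G_{v-u} is read off pi(G); lambda is a common denominator of the c_b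
    and of the coefficients of the g_i. *)

From HB Require Import structures.
Require Import Defs.
From mathcomp Require Import all_boot all_order all_algebra.
Set Implicit Arguments.
Unset Strict Implicit.
Unset Printing Implicit Defensive.
Import GRing.Theory.
Local Open Scope ring_scope.

(** * Common denominators in the fraction field *)

Section CommonDenominator.
Variable R : idomainType.
Local Open Scope quotient_scope.

Lemma fraction_denominator (x : {fraction R}) :
  exists c a : R, c != 0 /\ tofrac c * x = tofrac a.
Proof.
elim/quotW: x => x; exists (frac x).2, (frac x).1.
split; first exact: denom_ratioP.
rewrite !piE; apply/eqmodP => /=.
by rewrite FracField.equivfE !numden_Ratio ?mul1r ?mulr1 ?oner_eq0
           ?denom_ratioP // mulrC.
Qed.

(** The product of the individual denominators works, the index type being finite. This is the
    source of [lambda]. *)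
Lemma common_denominator (I : finType) (x : I -> {fraction R}) :
  exists2 c : R, c != 0 &
    exists a : I -> R, forall i, tofrac c * x i = tofrac (a i).
Proof.
have [e] := fin_all_exists (fun i => fraction_denominator (x i)).
case/fin_all_exists=> a ea; exists (\prod_i e i).
  by apply/prodf_neq0 => i _; case: (ea i).
exists (fun i => \prod_(j | j != i) e j * a i) => i.
by rewrite (bigD1 i) //= [e i * _]mulrC !tofracM -mulrA (proj2 (ea i)).
Qed.

End CommonDenominator.

Lemma sum_pick (T : eqType) (A : pzRingType) (r : seq T) (a : T) (f : T -> A) :
  uniq r -> \sum_(t <- r) (t == a)%:R * f t = (a \in r)%:R * f a.
Proof.
move=> ur; have [ar|ar] := boolP (a \in r).
  rewrite (bigD1_seq a) //= eqxx big1 ?addr0 // => t /negbTE ->.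
  by rewrite mul0r.
rewrite mul0r big_seq big1 // => t tr; case: eqP => [ta|]; last by rewrite mul0r.
by rewrite -ta tr in ar.
Qed.

(** * Exponents and monomials of fixed degree *)

Section Exponents.
Variable n : nat.
Implicit Types (s t w : 'X_{1..n.+1}) (v : expo n).

Lemma mexpo_inj : injective (@mexpo n).
Proof.
by move=> s t /ffunP st; apply/mnmP => i; have := st i; rewrite !ffunE => -[].
Qed.

Lemma mexpoD s t : mexpo (s + t)%MM = mexpo s + mexpo t.
Proof. by apply/ffunP => i; rewrite !ffunE mnmDE PoszD. Qed.

Lemma mons_val_inj l : injective (@mons_val n l).
Proof. by move=> s t /val_inj/val_inj. Qed.

Lemma mdeg_mons l (w : mons n l) : mdeg w = l.
Proof. by apply/eqP/(valP w). Qed.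

Lemma mons_surj l w : mdeg w = l -> exists w' : mons n l, w = w'.
Proof.
move=> wl; have wb : (mdeg w < l.+1)%N by rewrite wl.
have wl' : mdeg (BMultinom wb) == l by apply/eqP.
by exists (exist _ (BMultinom wb) wl').
Qed.

Lemma Dbasis_inj l v : injective (@Dbasis n l v).
Proof. by move=> s t /addrI/oppr_inj/mexpo_inj/mons_val_inj. Qed.

Lemma Dbasis_Dexps l v (u : mons n l) : Dbasis v u \in Dexps l v.
Proof. exact: image_f. Qed.

Lemma Bexps_degree l (B : {set mons n l}) v w :
  v - mexpo w \in Bexps B v -> mdeg w = l.
Proof.
case/imageP => b _ /addrI/oppr_inj/mexpo_inj ->; exact: mdeg_mons.
Qed.

Lemma Dexps_degree l v w : v - mexpo w \in Dexps l v -> mdeg w = l.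
Proof.
case/imageP => b _ /addrI/oppr_inj/mexpo_inj ->; exact: mdeg_mons.
Qed.

End Exponents.

(** * Sums over a support versus sums over one degree *)

Section MonomialSums.
Variables (n : nat) (K : nzRingType).
Implicit Types (P : {mpoly K[n.+1]}) (f : 'X_{1..n.+1} -> K).

Lemma sum_msupp_mons k P f :
  \sum_(s <- msupp P) P@_s * (if mdeg s == k then f s else 0)
  = \sum_(s : mons n k) P@_s * f s.
Proof.
(* The inner sum of deltas encodes the test on the degree of [s]. After exchange, each [w] picks
   [s = w], and a [w] outside the support has coefficient 0. *)
transitivity (\sum_(s <- msupp P) \sum_(w : mons n k)
    (s == w)%:R * (P@_s * f s)).
  apply: eq_bigr => s _; rewrite -big_distrl /=; case: eqP => sk.
    have [w ->] := mons_surj sk.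
    rewrite (bigD1 w) //= eqxx big1 ?addr0 ?mul1r // => t tw.
    by rewrite (inj_eq (@mons_val_inj n k)) eq_sym (negbTE tw).
  rewrite mulr0 big1 ?mul0r // => w _; case: eqP => // sw.
  by case: sk; rewrite sw mdeg_mons.
rewrite exchange_big; apply: eq_bigr => w _ /=.
rewrite (sum_pick (mons_val w) (fun s => P@_s * f s)) //.
by rewrite mcoeff_msupp; case: eqP => [->|]; rewrite /= ?mul1r // !mul0r.
Qed.

Lemma sum_msupp_homog k P f : P \is k.-homog ->
  \sum_(s <- msupp P) P@_s * f s = \sum_(s : mons n k) P@_s * f s.
Proof.
move=> /dhomogP hP; rewrite -sum_msupp_mons big_seq [RHS]big_seq.
by apply: eq_bigr => s /hP /= ->; rewrite eqxx.
Qed.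

End MonomialSums.

(** * Laurent products, matrix maps and the coefficient pairing *)

Section Laurent.
Variables (n : nat) (K : fieldType).
Implicit Types (P : {mpoly K[n.+1]}) (G : laurent n K).

Lemma coeff_laurent_of_mpoly P t :
  coeff t (laurent_of_mpoly P) = \sum_(w <- msupp P) (mexpo w == t)%:R * P@_w.
Proof.
rewrite raddf_sum; apply: eq_bigr => w _ /=.
by rewrite coeffU; case: eqP => _; rewrite ?mulr1 ?mul1r ?mulr0 ?mul0r.
Qed.

Lemma coeff_lmul_mpoly P G u :
  coeff u (lmul (laurent_of_mpoly P) G)
  = \sum_(t <- msupp P) P@_t * coeff (u - mexpo t) G.
Proof.
rewrite coeff_lmul.
under eq_bigr do rewrite coeff_laurent_of_mpoly big_distrl.
rewrite exchange_big big_seq [RHS]big_seq; apply: eq_bigr => w wP /=.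
under eq_bigr do rewrite eq_sym -mulrA.
rewrite (sum_pick _ (fun t => P@_w * coeff (u - t) G)) ?uniq_dom // mem_dom.
have -> : coeff (mexpo w) (laurent_of_mpoly P) = P@_w.
  rewrite coeff_laurent_of_mpoly.
  under eq_bigr do rewrite (inj_eq (@mexpo_inj n)).
  by rewrite sum_pick // wP mul1r.
by rewrite -mcoeff_msupp wP mul1r.
Qed.

Section MatrixMap.
Variables (I J : finType) (e : I -> expo n) (f : J -> expo n).
Variables (S T : {pred expo n}) (M : J -> I -> K).
Hypotheses (f_inj : injective f) (fT : forall j, f j \in T).

Definition mx_lmap_val G : laurent n K :=
  \sum_j << \sum_i M j i * coeff (e i) G *g f j >>.

Lemma coeff_mx_lmap_val G u :
  coeff u (mx_lmap_val G) = \sum_j (\sum_i M j i * coeff (e i) G) * (f j == u)%:R.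
Proof. by rewrite raddf_sum; apply: eq_bigr => j _ /=; rewrite coeffU. Qed.

Lemma mx_lmap_supported G : mx_lmap_val G \in lsupported T.
Proof.
apply/lsupportedP => u uT; rewrite coeff_mx_lmap_val big1 // => j _.
by case: eqP => [ju|]; rewrite ?mulr0 //; rewrite -ju fT in uT.
Qed.

Definition mx_lmap (G : lspace K S) : lspace K T := LSpace (mx_lmap_supported G).

Lemma mx_lmap_is_linear : linear mx_lmap.
Proof.
move=> c G H; apply/val_inj/eqP/freeg_eqP => u /=.
rewrite coeffD coeffZ !coeff_mx_lmap_val mulr_sumr -big_split /=.
apply: eq_bigr => j _; rewrite mulrA -mulrDl mulr_sumr -big_split /=.
by congr (_ * _); apply: eq_bigr => i _; rewrite coeffD coeffZ mulrDr mulrCA.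
Qed.

HB.instance Definition _ :=
  GRing.isLinear.Build K (lspace K S) (lspace K T) _ mx_lmap mx_lmap_is_linear.

(** Injectivity of [f] keeps different rows from contributing to the same coefficient. *)
Lemma mx_lmap_represents : represents e f mx_lmap M.
Proof.
move=> G j; rewrite /= coeff_mx_lmap_val (bigD1 j) //= eqxx mulr1.
by rewrite [X in _ + X]big1 ?addr0 // => i ij; rewrite (inj_eq f_inj) (negbTE ij) mulr0.
Qed.

End MatrixMap.

Lemma Dspace_eq l (v : expo n) (G H : Dspace K l v) :
  (forall u : mons n l, coeff (Dbasis v u) (lval G) = coeff (Dbasis v u) (lval H)) ->
  G = H.
Proof.
move=> GH; apply/val_inj/eqP/freeg_eqP => w /=.
have [/imageP[u _ ->]|wD] := boolP (w \in Dexps l v); first exact: GH.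
case: G H {GH} => [G hG] [H hH] /=.
by rewrite (lsupportedP _ _ hG) // (lsupportedP _ _ hH).
Qed.

(** The linear form P |-> (coefficient of x^v in P_l G) on polynomials. *)
Definition pairing l (v : expo n) G P : K :=
  \sum_(w : mons n l) P@_w * coeff (v - mexpo w) G.

Lemma pairing_is_scalar l v G : scalar (pairing l v G).
Proof.
move=> c P Q; rewrite /pairing mulr_sumr -big_split; apply: eq_bigr => w _ /=.
by rewrite mcoeffD mcoeffZ mulrDl mulrA.
Qed.

HB.instance Definition _ l v G :=
  GRing.isLinear.Build K {mpoly K[n.+1]} K _ (pairing l v G)
    (pairing_is_scalar l v G).

Lemma pairingX l v G k :
  pairing l v G 'X_[k] = if mdeg k == l then coeff (v - mexpo k) G else 0.
Proof.
rewrite /pairing; case: eqP => kl; last first.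
  rewrite big1 // => w _; rewrite mcoeffX; case: eqP => [kw|]; last by rewrite mul0r.
  by case: kl; rewrite kw mdeg_mons.
have [w ->] := mons_surj kl.
rewrite (bigD1 w) //= mcoeffX eqxx mul1r big1 ?addr0 // => t tw.
by rewrite mcoeffX (inj_eq (@mons_val_inj n l)) eq_sym (negbTE tw) mul0r.
Qed.

(** The pairing sees only degree l, so only the part of [P] of degree l - k survives. Cofactors
    coming from [in_IF] can thus be used as they are, without extracting homogeneous parts first. *)
Lemma pairingM l k v G P Q : (k <= l)%N -> Q \is k.-homog ->
  pairing l v G (P * Q)
  = \sum_(s : mons n (l - k)) P@_s *
      \sum_(t : mons n k) Q@_t * coeff (v - mexpo s - mexpo t) G.
Proof.
move=> kl hQ.
rewrite -(sum_msupp_mons (l - k)%N P (fun s =>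
  \sum_(t : mons n k) Q@_t * coeff (v - mexpo s - mexpo t) G)).
rewrite {1}(mpolyE P) mulr_suml linear_sum; apply: eq_bigr => s _ /=.
rewrite -scalerAl linearZ /=; congr (_ * _).
rewrite -(sum_msupp_homog (fun t => coeff (v - mexpo s - mexpo t) G) hQ).
rewrite {1}(mpolyE Q) mulr_sumr linear_sum /=.
(* As deg t = k <= l, the test deg s + deg t = l becomes deg s = l - k, independent of [t]. *)
transitivity (\sum_(t <- msupp Q)
    if mdeg s == (l - k)%N then Q@_t * coeff (v - mexpo s - mexpo t) G else 0).
  rewrite big_seq [RHS]big_seq; apply: eq_bigr => t tQ.
  rewrite -scalerAr linearZ /= -mpolyXD pairingX mdegD (dhomogP _ _ _ hQ t tQ) /=.
  by rewrite -{1}(subnK kl) eqn_add2r; case: eqP; rewrite ?mulr0 // mexpoD opprD addrA.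
by case: eqP => // _; rewrite big1.
Qed.

End Laurent.

Lemma mpolyX_mderiv n (K : comNzRingType) (i : 'I_n) (P : {mpoly K[n]}) :
  'X_i * P^`M(i) = \sum_(t <- msupp P) ((t i)%:R * P@_t) *: 'X_[t].
Proof.
rewrite {1}(mpolyE P) raddf_sum mulr_sumr; apply: eq_bigr => t _ /=.
rewrite mderivZ mderivX scalerA -scalerAr -mpolyXD [P@_t * _]mulrC.
(* When t_i = 0 the truncated exponent t - e_i is not restored by adding e_i, but the factor t_i
   kills the term. *)
have [ti|ti] := posnP (t i); first by rewrite ti mul0r !scale0r.
by rewrite addmC submK // lep1mP -lt0n.
Qed.

(** * Euler derivatives of F, coefficients of pi, and the expansion on E *)

Section Euler.
Variables (R : idomainType) (n d : nat) (F : {mpoly R[n.+1]}).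
Hypothesis hF : F \is d.-homog.

Lemma FK_homog : FK F \is d.-homog.
Proof.
apply/dhomogP => t; rewrite mcoeff_msupp mcoeff_map_mpoly tofrac_eq0 => tF.
by apply: (dhomogP _ _ _ hF); rewrite mcoeff_msupp.
Qed.

Lemma mcoeff_euler i t : (euler i (FK F))@_t = (t i)%:R * tofrac F@_t.
Proof.
rewrite /euler mpolyX_mderiv raddf_sum /= (eq_bigr (fun s => (s == t)%:R * ((s i)%:R * (FK F)@_s))).
  rewrite sum_pick // mcoeff_msupp -mcoeff_map_mpoly -/(FK F).
  by case: eqP => [->|]; rewrite /= ?mul1r // !mulr0.
by move=> s _; rewrite mcoeffZ mcoeffX mulrC.
Qed.

Lemma euler_homog i : euler i (FK F) \is d.-homog.
Proof.
rewrite /euler mpolyX_mderiv big_seq; apply: rpred_sum => t tF; apply: rpredZ.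
by rewrite dhomogX; apply/eqP/(dhomogP _ _ _ FK_homog).
Qed.

Variables (l : nat) (B : {set mons n l}).
Hypotheses (hd : (0 < d)%N) (hl : (d <= l)%N).

Lemma coeff_pi_mapB v (G : Dspace {fraction R} l v) (b : mons n l) : b \in B ->
  coeff (v - mexpo b) (lval (pi_map d F B v G)) = coeff (v - mexpo b) (lval G).
Proof.
move=> bB; rewrite coeffD !coeff_lrestr.
have -> : v - mexpo b \in Bexps B v by exact: image_f.
(* The two supports subtract monomials of degrees l and l - d, distinct because 0 < d <= l; so only
   one summand of pi contributes. *)
rewrite (negbTE (_ : v - mexpo b \notin Dexps (l - d) v)) ?mul1r ?mul0r ?addr0 //.
apply/negP => /Dexps_degree/eqP; rewrite mdeg_mons.
by rewrite -{1}(subnK hl) -{2}[(l - d)%N]addn0 eqn_add2l eqn0Ngt hd.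
Qed.

Lemma coeff_pi_mapD v (G : Dspace {fraction R} l v) (s : mons n (l - d)) :
  coeff (v - mexpo s) (lval (pi_map d F B v G))
  = \sum_(t : mons n d) tofrac F@_t * coeff (v - mexpo s - mexpo t) (lval G).
Proof.
rewrite coeffD !coeff_lrestr.
have -> : v - mexpo s \in Dexps (l - d) v by exact: image_f.
rewrite (negbTE (_ : v - mexpo s \notin Bexps B v)); last first.
  apply/negP => /Bexps_degree/eqP; rewrite mdeg_mons.
  by rewrite -{2}(subnK hl) -{1}[(l - d)%N]addn0 eqn_add2l eq_sym eqn0Ngt hd.
rewrite mul1r mul0r add0r coeff_lmul_mpoly.
rewrite (sum_msupp_homog (fun t => coeff (v - mexpo s - mexpo t) (lval G)) FK_homog).
by apply: eq_bigr => t _; rewrite mcoeff_map_mpoly.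
Qed.

Lemma pairing_mulX_F v (G : laurent n {fraction R}) (s : mons n (l - d)) :
  pairing l v G ('X_[s] * FK F)
  = \sum_(t : mons n d) tofrac F@_t * coeff (v - mexpo s - mexpo t) G.
Proof.
rewrite (pairingM _ _ _ hl FK_homog) (bigD1 s) //= mcoeffX eqxx mul1r.
rewrite [X in _ + X]big1 ?addr0; last first.
  move=> r rs; rewrite mcoeffX (inj_eq (@mons_val_inj n (l - d))) eq_sym.
  by rewrite (negbTE rs) mul0r.
by apply: eq_bigr => t _; rewrite mcoeff_map_mpoly.
Qed.

(** [c] and [g] are chosen before m, v and G, which makes [lambda] and the polynomial entries of psi
    uniform. The factor m + 1 is never divided out, since it may vanish in K. *)
Lemma E_coeff_expansion : quotient_basis F B ->
  exists (c : mons n l -> mons n l -> {fraction R})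
         (g : mons n l -> 'I_n.+1 * mons n (l - d) -> {fraction R}),
  forall m v (G : Dspace {fraction R} l v), in_E d F m G ->
  forall u : mons n l,
    m.+1%:R * coeff (v - mexpo u) (lval G)
    = m.+1%:R * (\sum_(b : mons n l | b \in B) c u b * coeff (v - mexpo b) (lval G)) +
      \sum_(s : mons n (l - d)) (\sum_i g u (i, s) * (v i - (s i)%:Z)%:~R) *
        (\sum_(t : mons n d) tofrac F@_t * coeff (v - mexpo s - mexpo t) (lval G)).
Proof.
case=> _ gen.
have homogX (u : mons n l) : ('X_[u] : {mpoly {fraction R}[n.+1]}) \is l.-homog.
  by rewrite dhomogX /= mdeg_mons.
have [c] := fin_all_exists (fun u => gen _ (homogX u)).
(* Only the coefficients of the cofactors in degree l - d are recorded. *)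
case/fin_all_exists=> g Eg; exists c, (fun u (z : 'I_n.+1 * mons n (l - d)) => (g u z.1)@_z.2).
move=> m v G GE u; have /(congr1 (pairing l v (lval G))) := Eg u.
rewrite linearB /= pairingX mdeg_mons eqxx => /eqP.
rewrite subr_eq => /eqP ->.
rewrite addrC !(linear_sum (pairing l v (lval G))) mulrDr; congr (_ * _ + _).
  by apply: eq_bigr => b _ /=; rewrite linearZ /= pairingX mdeg_mons eqxx.
under [RHS]eq_bigr do rewrite mulr_suml.
rewrite [RHS]exchange_big mulr_sumr; apply: eq_bigr => i _ /=.
rewrite (pairingM _ _ _ hl (euler_homog i)) mulr_sumr; apply: eq_bigr => s _ /=.
under eq_bigr do rewrite mcoeff_euler.
(* The equation of E at (s, i) trades (m + 1) times the coefficient of (d_i F) G at v - s for (v_i -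
   s_i) times that of F G. *)
by rewrite mulrCA -GE mulrA.
Qed.

End Euler.

(** * The matrices of pi and psi *)

Theorem lemma3p13 (R : idomainType) (hR : base_ring R)
    (n d : nat) (hd : (2 <= d)%N) (hdR : (d%:R : R) != 0)
    (F : {mpoly R[n.+1]}) (hF : F \is d.-homog)
    (B : forall l : nat, {set mons n l})
    (hB : forall l : nat, quotient_basis F (B l))
    (l : nat) (hl : (d <= l)%N) :
  (exists A : BDindex d (B l) -> mons n l -> R,
     forall (m : nat) (v : expo n), edeg v = (d * m + l)%:Z ->
       represents (Dbasis v) (BDbasis v) (pi_map d F (B l) v)
         (fun k u => tofrac (A k u)))
  /\
  (exists lambda : R, lambda != 0 /\
   exists psi : forall (m : nat) (v : expo n),
       {linear BDspace {fraction R} d (B l) v -> Dspace {fraction R} l v},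
     (forall (m : nat) (v : expo n), edeg v = (d * m + l)%:Z ->
        forall G : Dspace {fraction R} l v, in_E d F m G ->
          psi m v (pi_map d F (B l) v G) = tofrac (m.+1%:R * lambda) *: G)
     /\
     exists (a c : mons n l -> BDindex d (B l) -> R)
            (b : mons n l -> BDindex d (B l) -> 'I_n.+1 -> R),
       forall (m : nat) (v : expo n), edeg v = (d * m + l)%:Z ->
         represents (BDbasis v) (Dbasis v) (psi m v)
           (fun u k => tofrac (a u k + \sum_i b u k i * (v i)%:~R
                               + c u k * m%:R))).
Proof.
have d0 : (0 < d)%N by apply: ltnW.
split.
  (* Each row of pi is the pairing with a polynomial over R, namely x^b or x^s F; its entries are
     the coefficients of that polynomial, hence independent of v. *)
  exists (fun k u => match k with
    | inl b => ('X_[val b : mons n l] : {mpoly R[n.+1]})@_u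
    | inr s => ('X_[s : mons n (l - d)] * F)@_u
    end) => m v _ G [[b bB]|s] /=.
    rewrite coeff_pi_mapB //.
    transitivity (pairing l v (lval G) 'X_[(b : mons n l)]).
      by rewrite pairingX mdeg_mons eqxx.
    by apply: eq_bigr => u _; rewrite !mcoeffX rmorph_nat.
  rewrite coeff_pi_mapD // -pairing_mulX_F //.
  apply: eq_bigr => u _; rewrite -mcoeff_map_mpoly rmorphM /=.
  by rewrite map_mpolyX.
have [c [g cg]] := E_coeff_expansion hF hl (hB l).
(* A single finite sum type gathers all [c] and [g], so that one [lambda] clears them together. *)
have [lambda lambda0 [y hy]] := common_denominator
  (fun z : mons n l * mons n l + mons n l * ('I_n.+1 * mons n (l - d)) =>
     match z with inl ub => c ub.1 ub.2 | inr us => g us.1 us.2 end).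
exists lambda; split=> //.
(* [lambda] times the expansion dictates the entries. A column b carries y (m + 1), so y is both the
   constant term and the coefficient of m; a column s carries the sum of y_i (v_i - s_i), whose
   constant term is minus the sum of y_i s_i. *)
pose a u (k : BDindex d (B l)) := match k with
  | inl b => y (inl (u, val b))
  | inr s => - \sum_i y (inr (u, (i, s))) * (mons_val s i)%:R
  end.
pose a' u (k : BDindex d (B l)) := match k with
  | inl b => y (inl (u, val b))
  | inr s => 0
  end.
pose b u (k : BDindex d (B l)) i := match k with
  | inl b => 0
  | inr s => y (inr (u, (i, s)))
  end.
pose M m (v : expo n) u k : {fraction R} :=
  tofrac (a u k + \sum_i b u k i * (v i)%:~R + a' u k * m%:R).
exists (fun m v => @mx_lmap n _ _ _ (@BDbasis n l d (B l) v) (@Dbasis n l v)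
  (BDexps d (B l) v) (mem (Dexps l v)) (M m v) (@Dbasis_Dexps n l v)).
split; last first.
  by exists a, a', b => m v _; apply: mx_lmap_represents; apply: Dbasis_inj.
move=> m v _ G GE; apply: Dspace_eq => u.
rewrite (mx_lmap_represents _ _ (@Dbasis_inj n l v)) coeffZ.
(* The two kinds of columns match the two sums of the expansion. *)
rewrite tofracM rmorph_nat mulrAC (cg _ _ _ GE u) mulrDl big_sumType /=.
congr (_ + _).
  rewrite [in RHS](big_sub (mem (B l))
    (fun b : mons n l => c u b * coeff (v - mexpo b) (lval G))).
  rewrite mulr_sumr mulr_suml; apply: eq_bigr => -[b' b'B] _ /=.
  rewrite coeff_pi_mapB //= /M /= big1 => [|i _]; last by rewrite mul0r.
  rewrite addr0 tofracD tofracM rmorph_nat -(hy (inl (u, b'))) /=.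
  rewrite -[X in X + _]mulr1 -mulrDr -mulrS [RHS]mulrC -!mulrA.
  by congr (_ * _); rewrite mulrCA.
rewrite mulr_suml; apply: eq_bigr => s _; rewrite coeff_pi_mapD // /M /=.
rewrite mul0r addr0 mulrAC; congr (_ * _).
rewrite addrC -sumrB rmorph_sum mulr_suml; apply: eq_bigr => i _ /=.
rewrite -mulrBr tofracM -(hy (inr (u, (i, s)))) /= [RHS]mulrC mulrA.
congr (_ * _).
by rewrite tofracB rmorph_int rmorph_nat [X in _ - X]pmulrn -intrB.
Qed.
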